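(* Let $L$ be a logic on the propositional language $\mathcal{L}$ with class of models $\Omega_L$, and suppose that for all $\varphi,\psi\in\mathcal{L}$ and all $v\in\Omega_L$: - if $\vdash_L\varphi$ then $v\models_L\varphi$ (soundness); - $v\models_L\varphi\leftrightarrow\psi$ iff ($v\models_L\neg\varphi\Leftrightarrow v\models_L\neg\psi$); - $v\models_L\neg(\varphi\vee\psi)$ iff $v\models_L\neg\varphi$ and $v\models_L\neg\psi$. Then for every $L$-possibility distribution $\pi:\Omega_L\to[0,1]$, the mapping $f_4(\pi):\mathcal{L}\to[0,1]$ defined by $f_4(\pi)(\varphi)=\sup\{\pi(v): v\not\models_L\neg\varphi\}$ is an $L$-possibility function.
   Context: $\mathcal{L}$ is a classical propositional language, built from a list of propositional variables and the connectives $\neg,\wedge,\vee,\to,\leftrightarrow$. A logic $L$ on $\mathcal{L}$ is given by a (possibly non-classical) consequence relation $\vdash_L$; $\vdash_L\varphi$ means that $\varphi$ is a theorem of $L$. $\vdash_L\varphi\leftrightarrow\psi$ is a shorthand for ''$\vdash_L\varphi\to\psi$ and $\vdash_L\psi\to\varphi$''; likewise $v\models_L\varphi\leftrightarrow\psi$ stands for ''$v\models_L\varphi\to\psi$ and $v\models_L\psi\to\varphi$''. $\Omega_L$ is the class of $L$-models and $v\models_L\varphi$ means that $v\in\Omega_L$ satisfies $\varphi$. An $L$-possibility distribution is a mapping $\pi:\Omega_L\to[0,1]$. Convention: $\sup\emptyset=0$. An $L$-possibility function is a mapping $\Pi:\mathcal{L}\to[0,1]$ such that for all $\varphi,\psi$: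 (Contr) if $\vdash_L\neg\varphi$ then $\Pi(\varphi)=0$; (Eq$_\Pi$) if $\vdash_L\varphi\leftrightarrow\psi$ then $\Pi(\varphi)=\Pi(\psi)$; (Disj) $\Pi(\varphi\vee\psi)=\max(\Pi(\varphi),\Pi(\psi))$. *)

(* Defs.v *)
From HB Require Import structures.
From mathcomp Require Import all_boot all_order all_algebra.
From mathcomp Require Import boolp classical_sets reals.

Set Implicit Arguments.
Unset Strict Implicit.
Unset Printing Implicit Defensive.

Import Order.TTheory GRing.Theory Num.Theory.

Local Open Scope classical_set_scope.
Local Open Scope ring_scope.

Inductive formula (var : Type) : Type :=
| Var of var
| Neg of formula var
| And of formula var & formula var
| Or of formula var & formula var
| Imp of formula var & formula var
| Iff of formula var & formula var.

(* No closure condition (reflexivity, monotonicity, cut, structurality) is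
   imposed on the consequence relation, and no truth-functionality on
   satisfaction: both are arbitrary relations. *)
Record logic (var : Type) : Type := Logic {
  entails : set (formula var) -> formula var -> Prop;
  model : Type;
  sat : model -> formula var -> Prop }.

Section Logic.
Context {var : Type} (L : logic var).
Implicit Types (phi psi : formula var) (v : model L).

Definition provable phi : Prop := entails L set0 phi.

(* An asserted biconditional is shorthand for the two implications; it is not
   the assertion of the formula [Iff phi psi]. *)
Definition provable_iff phi psi : Prop :=
  provable (Imp phi psi) /\ provable (Imp psi phi).

Definition sat_iff v phi psi : Prop :=
  sat v (Imp phi psi) /\ sat v (Imp psi phi).

Definition sound : Prop := forall phi v, provable phi -> sat v phi.

Context {R : realType}.

Definition possibility_distribution (pi : model L -> R) : Prop :=
  forall v, 0 <= pi v <= 1.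

Record possibility_function (Pi : formula var -> R) : Prop := {
  poss_range : forall phi, 0 <= Pi phi <= 1;
  poss_contr : forall phi, provable (Neg phi) -> Pi phi = 0;
  poss_eq : forall phi psi, provable_iff phi psi -> Pi phi = Pi psi;
  poss_disj : forall phi psi, Pi (Or phi psi) = Num.max (Pi phi) (Pi psi) }.

(* [sup set0 = 0] in the library, and for a [0, 1]-valued [pi] the set below is
   bounded, so [sup] is its least upper bound as soon as it is nonempty. *)
Definition f4 (pi : model L -> R) (phi : formula var) : R :=
  sup [set pi v | v in [set v | ~ sat v (Neg phi)]].

End Logic.

(* Main.v *)
(** For a subset [A] of [[0, 1]], possibly empty, and [z >= 0], [sup A <= z]
    holds exactly when [z] bounds [A]. Hence the supremum of a union is the
    maximum of the suprema, which is the disjunction axiom: the models not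
    satisfying [Neg (Or phi psi)] are those not satisfying [Neg phi] or not
    satisfying [Neg psi]. *)
Require Import Defs.
From HB Require Import structures.
From mathcomp Require Import all_boot all_order all_algebra.
From mathcomp Require Import boolp classical_sets reals.

Import Order.TTheory GRing.Theory Num.Theory.

Local Open Scope classical_set_scope.
Local Open Scope ring_scope.

Lemma has_ubound_unit (R : realType) (A : set R) :
  (forall x, A x -> 0 <= x <= 1) -> has_ubound A.
Proof. by move=> A01; exists 1 => x /A01 /andP[]. Qed.

(** A nonempty [A] has a nonnegative element below its supremum; for the empty set, the default
    value [sup set0 = 0] suffices. *)
Lemma sup_nneg (R : realType) (A : set R) :
  (forall x, A x -> 0 <= x <= 1) -> 0 <= sup A.
Proof.
move=> A01; have [->|/set0P[x Ax]] := eqVneq A set0.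
  by rewrite sup0.
have /andP[x0 _] := A01 x Ax.
exact: le_trans x0 (ub_le_sup (has_ubound_unit _ _ A01) Ax).
Qed.

(** The condition [0 <= z] serves the empty set, which every [z] bounds vacuously although its
    supremum is 0. *)
Lemma sup_leP (R : realType) (A : set R) (z : R) :
  (forall x, A x -> 0 <= x <= 1) -> 0 <= z ->
  sup A <= z <-> forall x, A x -> x <= z.
Proof.
move=> A01 z0; split=> [supAz x Ax|Az].
  exact: le_trans (ub_le_sup (has_ubound_unit _ _ A01) Ax) supAz.
have [->|/set0P A0] := eqVneq A set0; first by rewrite sup0.
exact: ge_sup.
Qed.

Lemma sup_setU_unit (R : realType) (A B : set R) :
  (forall x, A x -> 0 <= x <= 1) -> (forall x, B x -> 0 <= x <= 1) ->
  sup (A `|` B) = Num.max (sup A) (sup B).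
Proof.
move=> A01 B01.
have AB01 x : (A `|` B) x -> 0 <= x <= 1 by case=> [/A01|/B01].
have ub C x : (forall y, C y -> 0 <= y <= 1) -> C x -> x <= sup C.
  by move=> C01; exact/ub_le_sup/has_ubound_unit.
apply/le_anti/andP; split.
  apply/sup_leP => //; first by rewrite le_max sup_nneg.
  by move=> x [/ub xA|/ub xB]; rewrite le_max ?xA ?xB ?orbT.
rewrite ge_max; apply/andP; split; apply/sup_leP => //;
  try exact: sup_nneg.
- by move=> x Ax; apply: ub => //; left.
- by move=> x Bx; apply: ub => //; right.
Qed.

Theorem proposition15 (R : realType) (var : Type) (L : logic var)
  (Hsound : sound L)
  (Hiff : forall (phi psi : formula var) (v : model L),
     sat_iff v phi psi <-> (sat v (Neg phi) <-> sat v (Neg psi)))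
  (Hor : forall (phi psi : formula var) (v : model L),
     sat v (Neg (Or phi psi)) <-> sat v (Neg phi) /\ sat v (Neg psi)) :
  forall pi : model L -> R,
    possibility_distribution pi -> possibility_function L (f4 pi).
Proof.
move=> pi pi01.
have im01 (D : set (model L)) x : (pi @` D) x -> 0 <= x <= 1.
  by move=> [v _ <-]; exact: pi01.
pose S phi := [set v : model L | ~ sat v (Neg phi)].
split=> [phi|phi prov|phi psi [prov1 prov2]|phi psi]; rewrite /f4.
- apply/andP; split; first exact: sup_nneg (im01 _).
  by apply/sup_leP => [x|//|x] /im01 // /andP[].
(* By soundness every model satisfies [Neg phi], so the supremum is that of the empty set. *)
- suff : S phi = set0 by rewrite /S => ->; rewrite image_set0 sup0.
  by apply/seteqP; split=> v //=; apply; exact: Hsound.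
(* The value at [phi] depends only on [S phi]. Soundness yields both implications at each model, and
   [Hiff] turns them into agreement on the negations. *)
- suff : S phi = S psi by rewrite /S => ->.
  have E (v : model L) : sat v (Neg phi) <-> sat v (Neg psi).
    by apply/Hiff; split; exact: Hsound.
  by apply/seteqP; split=> v /= nsat /E.
- rewrite -sup_setU_unit; [|exact: im01|exact: im01].
  rewrite -image_setU.
  suff : S (Or phi psi) = S phi `|` S psi by rewrite /S => ->.
  apply/seteqP; split=> v /=.
    (* This inclusion is the classical half of De Morgan: a failed conjunction has a failed
       conjunct. *)
    by move=> nsat; apply/not_andP => /Hor.
  by move=> [nsat|nsat] /Hor[].
Qed.
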